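(* For Leibniz algebras over fields of characteristic $0$, being triangulable is a 2-recognizable property; that is, if $A$ is a finite-dimensional Leibniz algebra over a field $F$ of characteristic $0$ such that every subalgebra of $A$ generated by two elements is triangulable, then $A$ is triangulable.
   Context: A Leibniz algebra over a field $F$ is an $F$-vector space $A$ with a bilinear product satisfying the (left) Leibniz identity $x(yz) = (xy)z + y(xz)$ for all $x,y,z \in A$. Let $K$ be the algebraic closure of $F$. A finite-dimensional Leibniz algebra $N$ over $F$ is called triangulable (on itself) if $K \otimes_F N$, a Leibniz algebra over $K$, has a $K$-basis with respect to which the matrices of all left multiplications $a \mapsto xa$ and all right multiplications $a \mapsto ax$, $x \in K \otimes_F N$, are upper triangular; a subalgebra is called triangulable when it is triangulable on itself. A property is $n$-recognizable in a class of algebras if, whenever all $n$-generated subalgebras of an algebra in the class have the property, then the algebra has the property. *)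

(* Defs.v *)
From HB Require Import structures.
From mathcomp Require Import all_boot all_order all_algebra.

Set Implicit Arguments.
Unset Strict Implicit.
Unset Printing Implicit Defensive.

Import GRing.Theory.
Local Open Scope ring_scope.

(* Finite-dimensional left Leibniz algebras: the vectType structure carries    *)
(* the finite dimension, and lmul x y is the product x y.                      *)
HB.mixin Record Vector_isLeibniz (F : fieldType) A of Vector F A := {
  lmul : A -> A -> A;
  lmul_bilinear : bilinear_for *:%R *:%R lmul;
  leibniz_identity : forall x y z : A,
    lmul x (lmul y z) = lmul (lmul x y) z + lmul y (lmul x z)
}.

#[short(type="leibnizType")]
HB.structure Definition Leibniz (F : fieldType) :=
  { A of Vector F A & Vector_isLeibniz F A }.

Section LeibnizTheory.
Variables (F : fieldType) (A : leibnizType F).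
Implicit Types x y : A.

HB.instance Definition _ x :=
  GRing.isLinear.Build F A A *:%R (lmul x) (lmul_bilinear.2 x).

Definition rmul y x : A := lmul x y.

HB.instance Definition _ y :=
  GRing.isLinear.Build F A A *:%R (rmul y) (lmul_bilinear.1 y).

Lemma lmulDl y : {morph (fun x => lmul x y) : x1 x2 / x1 + x2}.
Proof. exact: (linearD (rmul y)). Qed.

Lemma lmulZl a x y : lmul (a *: x) y = a *: lmul x y.
Proof. exact: (linearZ_LR (rmul y)). Qed.

Lemma lmul_suml I (r : seq I) (P : pred I) (f : I -> A) y :
  lmul (\sum_(i <- r | P i) f i) y = \sum_(i <- r | P i) lmul (f i) y.
Proof. exact: (linear_sum (rmul y)). Qed.

End LeibnizTheory.

Record subleibniz (F : fieldType) (A : leibnizType F) := Subleibniz {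
  subleibniz_vspace :> {vspace A};
  subleibniz_closed :
    {in subleibniz_vspace &, forall x y, lmul x y \in subleibniz_vspace}
}.

Section SubLeibnizType.
Variables (F : fieldType) (A : leibnizType F) (U : subleibniz A).

Definition subvs_lmul (x y : subvs_of U) : subvs_of U :=
  Subvs (subleibniz_closed (subvsP x) (subvsP y)).

Fact subvs_lmul_bilinear : bilinear_for *:%R *:%R subvs_lmul.
Proof.
split=> [y a x1 x2|x a y1 y2]; apply: val_inj; rewrite /=.
  by rewrite lmulDl lmulZl.
by rewrite linearP.
Qed.

Fact subvs_leibniz x y z : subvs_lmul x (subvs_lmul y z)
  = subvs_lmul (subvs_lmul x y) z + subvs_lmul y (subvs_lmul x z).
Proof. by apply: val_inj; apply: leibniz_identity. Qed.

HB.instance Definition _ :=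
  Vector_isLeibniz.Build F (subvs_of U) subvs_lmul_bilinear subvs_leibniz.

End SubLeibnizType.

Definition generated_by (F : fieldType) (A : leibnizType F) (X : seq A)
    (U : subleibniz A) : Prop :=
  {subset X <= U} /\
  forall V : subleibniz A, {subset X <= V} -> (U <= V)%VS.

Lemma generated_by_exists (F : fieldType) (A : leibnizType F) (X : seq A) :
  exists U : subleibniz A, generated_by X U.
Proof.
suff H n (W : {vspace A}) : (\dim {:A} - \dim W <= n)%N -> {subset X <= W} ->
    (forall V : subleibniz A, {subset X <= V} -> (W <= V)%VS) ->
    exists U : subleibniz A, generated_by X U.
  apply: (H _ <<X>>%VS (leqnn _)) => [x|V XV]; first exact: memv_span.
  by apply/span_subvP.
elim: n W => [|n IHn] W dimW XW minW.
  have WT : (W == fullv)%VS by rewrite eqEdim subvf -subn_eq0 -leqn0.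
  have clW : {in W &, forall x y : A, lmul x y \in W}.
    by move=> x y _ _; rewrite (eqP WT) memvf.
  by exists (Subleibniz clW).
pose S := [seq lmul x y | x <- vbasis W, y <- vbasis W].
pose W' := (W + <<S>>)%VS.
have clW x y : x \in W -> y \in W -> lmul x y \in W'.
  move=> xW yW; apply: (subvP (addvSr _ _)).
  rewrite (coord_vbasis xW) lmul_suml rpred_sum // => i _.
  rewrite lmulZl rpredZ // (coord_vbasis yW) linear_sum rpred_sum // => j _.
  rewrite linearZ rpredZ // memv_span //; apply: allpairs_f;
    by rewrite mem_nth // size_tuple.
have WW' : (W <= W')%VS by apply: addvSl.
have [W'W|nW'W] := boolP (W' <= W)%VS.
  have clW' : {in W &, forall x y : A, lmul x y \in W}.
    by move=> x y xW yW; apply: (subvP W'W); apply: clW.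
  by exists (Subleibniz clW').
have ltW : (\dim W < \dim W')%N by rewrite (ltn_leqif (dimv_leqif_sup WW')).
apply: (IHn W') => [|x xX|V XV].
- rewrite -ltnS (leq_trans _ dimW) // ltn_sub2l //.
  by rewrite (leq_trans ltW) // dimvS // subvf.
- by rewrite (subvP WW') // XW.
rewrite subv_add minW //=; apply/span_subvP => _ /allpairsP[[x y] /= [xW yW ->]].
have WV := subvP (minW V XV).
by apply: subleibniz_closed; apply: WV; apply: vbasis_mem.
Qed.

(* The scalar extension K \otimes_F N along iota : F -> K, realized as row     *)
(* vectors over K: the coordinates with respect to the K-basis 1 \otimes b_i,  *)
(* for the F-basis b = vbasis {:N} of N. The element 1 \otimes x is tens1 x;   *)
(* scalext_universal is the universal property of the scalar extension.        *)
Definition scalext (F K : fieldType) (iota : {rmorphism F -> K})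
  (N : vectType F) : Type := 'rV[K]_(\dim {:N}).

Section ScalarExtension.
Variables (F K : fieldType) (iota : {rmorphism F -> K}).

HB.instance Definition _ (N : vectType F) := Vector.on (scalext iota N).

Section Vect.
Variable N : vectType F.
Local Notation KN := (scalext iota N).
Local Notation b := (vbasis {:N}).

Definition tens1 (x : N) : KN := \row_i iota (coord b i x).

Lemma tens1D : {morph tens1 : x y / x + y}.
Proof. by move=> x y; apply/rowP=> i; rewrite !mxE linearD rmorphD. Qed.

Lemma tens1Z a x : tens1 (a *: x) = iota a *: tens1 x.
Proof. by apply/rowP=> i; rewrite !mxE linearZ rmorphM. Qed.

Lemma tens1_basis (i : 'I_(\dim {:N})) : tens1 b`_i = delta_mx 0 i.
Proof.
apply/rowP=> j; rewrite !mxE coord_free ?(basis_free (vbasisP _)) //.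
by rewrite eqxx eq_sym; case: eqP => _; rewrite ?rmorph0 ?rmorph1.
Qed.

Lemma scalext_sum (u : KN) : u = \sum_i u 0 i *: tens1 b`_i.
Proof.
by rewrite [LHS]row_sum_delta; apply: eq_bigr => i _; rewrite tens1_basis.
Qed.

Lemma scalext_universal (W : lmodType K) (f : N -> W) :
    {morph f : x y / x + y} -> (forall a x, f (a *: x) = iota a *: f x) ->
  exists2 g : {linear KN -> W}, (forall x, g (tens1 x) = f x) &
    forall g' : {linear KN -> W}, (forall x, g' (tens1 x) = f x) -> g' =1 g.
Proof.
move=> fD fZ; pose g (u : KN) := \sum_i u 0 i *: f b`_i.
have g_lin : linear g.
  move=> a u v; rewrite /g scaler_sumr -big_split; apply: eq_bigr => i _ /=.
  by rewrite !mxE scalerDl scalerA.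
pose gL := GRing.isLinear.Build K KN W *:%R g g_lin.
pose G : {linear KN -> W} := HB.pack g gL.
have f0 : f 0 = 0 by rewrite -(scale0r 0) fZ rmorph0 scale0r.
exists G => [x|g' g'f u].
  rewrite [in RHS](coord_vbasis (memvf x)) (big_morph f fD f0).
  by apply: eq_bigr => i _; rewrite mxE fZ.
rewrite {1}(scalext_sum u) linear_sum; apply: eq_bigr => i _.
by rewrite linearZ g'f.
Qed.

End Vect.

Section Leib.
Variable N : leibnizType F.
Local Notation KN := (scalext iota N).
Local Notation b := (vbasis {:N}).

(* The K-bilinear product with (1 \otimes x)(1 \otimes y) = 1 \otimes xy, see  *)
(* scalext_lmul_tens1.                                                         *)
Definition scalext_lmul (u v : KN) : KN :=
  \sum_i \sum_j (u 0 i * v 0 j) *: tens1 (lmul b`_i b`_j).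

Fact scalext_lmul_bilinear : bilinear_for *:%R *:%R scalext_lmul.
Proof.
split=> [v a u1 u2|u a v1 v2]; rewrite /scalext_lmul /= scaler_sumr -big_split;
  apply: eq_bigr => i _ /=; rewrite scaler_sumr -big_split;
  apply: eq_bigr => j _ /=; rewrite !mxE scalerA -scalerDl.
  by rewrite mulrDl mulrA.
by rewrite mulrDr mulrCA.
Qed.

Lemma scalext_lmul_tens1 x y :
  scalext_lmul (tens1 x) (tens1 y) = tens1 (lmul x y).
Proof.
have t0 : tens1 (0 : N) = 0 :> KN by rewrite -(scale0r 0) tens1Z rmorph0 scale0r.
have tS := big_morph (fun z : N => tens1 z : KN) (@tens1D N) t0.
rewrite [in RHS](coord_vbasis (memvf x)) lmul_suml tS.
apply: eq_bigr => i _; rewrite lmulZl tens1Z.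
rewrite [in RHS](coord_vbasis (memvf y)) linear_sum tS scaler_sumr.
by apply: eq_bigr => j _; rewrite linearZ tens1Z scalerA !mxE.
Qed.

Let mul := scalext_lmul.
Let mulP1 a u1 u2 v : mul (a *: u1 + u2) v = a *: mul u1 v + mul u2 v.
Proof. exact: scalext_lmul_bilinear.1. Qed.
Let mulP2 a u v1 v2 : mul u (a *: v1 + v2) = a *: mul u v1 + mul u v2.
Proof. exact: scalext_lmul_bilinear.2. Qed.

Let scalext_ind (P : KN -> Prop) :
  (forall x, P (tens1 x)) ->
  (forall a u v, P u -> P v -> P (a *: u + v)) -> forall u, P u.
Proof.
move=> P1 PL u; rewrite (scalext_sum u).
have P0 : P 0.
  by have := P1 0; rewrite -(scale0r (0 : N)) tens1Z rmorph0 scale0r.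
elim/big_rec: _ => // i w _ Pw; exact: PL.
Qed.

Fact scalext_leibniz u v w : mul u (mul v w) = mul (mul u v) w + mul v (mul u w).
Proof.
elim/scalext_ind: u => [x|a u1 u2 IH1 IH2]; last first.
  by rewrite !(mulP1, mulP2) IH1 IH2 scalerDr addrACA.
elim/scalext_ind: v => [y|a u1 u2 IH1 IH2]; last first.
  by rewrite !(mulP1, mulP2) IH1 IH2 scalerDr addrACA.
elim/scalext_ind: w => [z|a u1 u2 IH1 IH2]; last first.
  by rewrite !(mulP1, mulP2) IH1 IH2 scalerDr addrACA.
by rewrite /mul !scalext_lmul_tens1 -tens1D leibniz_identity.
Qed.

HB.instance Definition _ :=
  Vector_isLeibniz.Build K KN scalext_lmul_bilinear scalext_leibniz.

End Leib.
End ScalarExtension.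

(* Column convention, opposite to that of mxof.                                *)
Definition matrix_in (K : fieldType) (V : vectType K) n (e : n.-tuple V)
  (f : V -> V) : 'M[K]_n := \matrix_(i, j) coord e i (f e`_j).

Definition upper_triangular (K : fieldType) n (M : 'M[K]_n) : Prop :=
  forall i j : 'I_n, (j < i)%N -> M i j = 0.

Definition triangulable (F K : fieldType) (iota : {rmorphism F -> K})
    (N : leibnizType F) : Prop :=
  exists2 e : (\dim {:scalext iota N}).-tuple (scalext iota N),
    basis_of {:scalext iota N} e &
    forall x : scalext iota N,
      upper_triangular (matrix_in e (fun a => lmul x a)) /\
      upper_triangular (matrix_in e (fun a => lmul a x)).

(* The class in which P is recognizable is that of all finite-dimensional      *)
(* Leibniz algebras over F.                                                    *)
Definition recognizable (F : fieldType) (n : nat)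
    (P : leibnizType F -> Prop) : Prop :=
  forall A : leibnizType F,
    (forall (X : n.-tuple A) (U : subleibniz A),
       generated_by X U -> P (subvs_of U)) ->
    P A.

(* Main.v *)
Require Import Defs.
From HB Require Import structures.
From mathcomp Require Import all_boot all_order all_algebra.
From Stdlib Require Import Classical.

(** Write L_x and R_x for the left and right multiplications of A by x, and A_K
for K tensor A. Being triangulable means that A_K has a full flag of two-sided
ideals, that is, that A_K has only one-dimensional irreducible sections as a
module under all the L_x and R_x.

The hypothesis on pairs is used only to show that every L_(xy) is nilpotent on
A_K. Let U be the subalgebra generated by x and y. Since U is triangulable, the
operators L_u, for u in K tensor U, form a Lie algebra with a full flag of
ideals, acting on A_K. By Lie's theorem (lie_irreducible_scalar, where
characteristic 0 enters through traces) this Lie algebra acts by scalars on its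
irreducible sections. There L_(xy), the commutator of L_x and L_y,
vanishes, hence it is nilpotent (subalgebra_product_nilpotent).

The set S of all the L_(xy), for x and y in A, need not be a subspace but is
closed under commutators, because the commutator of L_a and L_b is L_(ab). The
theorem of Engel and Jacobson on weakly closed sets (weakly_closed_nil) thus
says that long products of elements of S vanish; in particular S has a nonzero
common kernel on any section that it acts on.

Now take an irreducible section of A_K under all the L_x and R_x. The identity
(xy + yx)z = 0 shows that there either all the R_x vanish or R_x = - L_x for
all x, so that only the L_x matter. The common kernel of S is nonzero and
stable under them, so S acts by zero, the L_x commute, and the section has
dimension 1 (irreducible_bimodule_dim1). Choosing such sections one after the
other gives the flag (triangular_flag).

Operators are matrices acting on row vectors, on the right. So products are
reversed: Lmx (xy) is the bracket of Lmx y and Lmx x. *)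

Set Implicit Arguments.
Unset Strict Implicit.
Unset Printing Implicit Defensive.

Import GRing.Theory.
Local Open Scope ring_scope.

(** * Stable subspaces and irreducible sections *)

Definition stable_family (K : fieldType) m n (I : Type) (rho : I -> 'M[K]_n)
  (W : 'M_(m, n)) : Prop := forall i, stablemx W (rho i).

Definition irreducible_family (K : fieldType) n (I : Type)
    (rho : I -> 'M[K]_n) : Prop :=
  (0 < n)%N /\
  forall W : 'M_n, stable_family rho W -> W = 0 \/ row_full W.

Definition bracketmx (K : fieldType) n (f g : 'M[K]_n) := f *m g - g *m f.

Section Commutator.
Variables (K : fieldType) (n : nat).
Implicit Types f g h : 'M[K]_n.

Lemma bracketmxDl f g h : bracketmx (f + g) h = bracketmx f h + bracketmx g h.
Proof. by rewrite /bracketmx mulmxDl mulmxDr opprD addrACA. Qed.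

Lemma bracketmxZl a f g : bracketmx (a *: f) g = a *: bracketmx f g.
Proof. by rewrite /bracketmx -scalemxAl -scalemxAr scalerBr. Qed.

Lemma bracketmxN f g : bracketmx f g = - bracketmx g f.
Proof. by rewrite /bracketmx opprB. Qed.

Lemma bracketmxDr f g h : bracketmx h (f + g) = bracketmx h f + bracketmx h g.
Proof. by rewrite bracketmxN bracketmxDl opprD -!bracketmxN. Qed.

Lemma bracketmxZr a f g : bracketmx g (a *: f) = a *: bracketmx g f.
Proof. by rewrite bracketmxN bracketmxZl -scalerN -bracketmxN. Qed.

Lemma bracket0mx f : bracketmx 0 f = 0.
Proof. by rewrite /bracketmx mul0mx mulmx0 subrr. Qed.

Lemma mxtrace_bracketmx f g : \tr (bracketmx f g) = 0.
Proof. by rewrite /bracketmx linearB /= mxtrace_mulC subrr. Qed.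

End Commutator.

(** The section M / W is identified with row vectors of length rank (M :\: W),
through the basis secbase of a complement of W in M. Then secmx f is the matrix
induced on M / W by f, when f stabilizes M and W. *)
Section StableSection.
Variables (K : fieldType) (n : nat) (W M : 'M[K]_n).

Definition secbase : 'M_(_, n) := row_base (M :\: W)%MS.
Definition secproj : 'M_n := proj_mx (M :\: W)%MS W.
Definition secmx (f : 'M_n) : 'M_(\rank (M :\: W)) :=
  conjmx secbase (f *m secproj).

Lemma secmxD f g : secmx (f + g) = secmx f + secmx g.
Proof. by rewrite /secmx /conjmx mulmxDl mulmxDr mulmxDl. Qed.

Lemma secmxN f : secmx (- f) = - secmx f.
Proof. by rewrite /secmx /conjmx mulNmx mulmxN mulNmx. Qed.

Lemma secmxZ a f : secmx (a *: f) = a *: secmx f.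
Proof. by rewrite /secmx /conjmx -scalemxAl -scalemxAr -scalemxAl. Qed.

Lemma secmx0 : secmx 0 = 0.
Proof. by rewrite -(scale0r 0) secmxZ scale0r. Qed.

Lemma secmx_sum (J : finType) (f : J -> 'M_n) :
  secmx (\sum_j f j) = \sum_j secmx (f j).
Proof. exact: (big_morph _ secmxD secmx0). Qed.

Hypothesis WM : (W <= M)%MS.

Lemma secbase_sub : (secbase <= M)%MS.
Proof. by rewrite eq_row_base diffmxSl. Qed.

Lemma eqmx_add_secbase : (W + secbase :=: M)%MS.
Proof.
apply: eqmx_trans (addsmx_diff_cap_eq M W); rewrite addsmxC.
by apply: adds_eqmx (eq_row_base _) _; apply/eqmx_sym/capmx_idPr.
Qed.

Lemma rank_section : \rank M = (\rank W + \rank (M :\: W))%N.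
Proof. by rewrite -(mxrank_cap_compl M W) (capmx_idPr WM). Qed.

Lemma section_gt0 : ~~ (M <= W)%MS -> (0 < \rank (M :\: W))%N.
Proof.
move=> nMW; have: (W < M)%MS by rewrite ltmxE WM.
by rewrite ltmxErank WM /= rank_section -[ltnLHS]addn0 ltn_add2l.
Qed.

Lemma sub_secproj m (X : 'M_(m, n)) : (X <= M)%MS ->
  (X - X *m secproj *m pinvmx secbase *m secbase <= W)%MS.
Proof.
move=> XM; rewrite mulmxKpV ?eq_row_base ?proj_mx_sub //.
apply: proj_mx_compl_sub; apply: submx_trans XM _.
by rewrite -eqmx_add_secbase addsmxC addsmxS ?eq_row_base.
Qed.

Lemma secproj_sub0 m (X : 'M_(m, n)) : (X <= W)%MS -> X *m secproj = 0.
Proof. by apply: proj_mx_0; apply: capmx_diff. Qed.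

Lemma secmx_sub f : stablemx M f ->
  (secbase *m f - secmx f *m secbase <= W)%MS.
Proof.
move=> Mf; rewrite /secmx /conjmx mulmxA sub_secproj //.
by rewrite (submx_trans _ Mf) ?submxMr ?secbase_sub.
Qed.

Lemma secmxM f g : stablemx M f -> stablemx W g ->
  secmx (f *m g) = secmx f *m secmx g.
Proof.
move=> Mf Wg; have := submxMr g (secmx_sub Mf) => /submx_trans/(_ Wg).
move=> /secproj_sub0/(congr1 (mulmx^~ (pinvmx secbase))); rewrite mul0mx.
rewrite !mulmxBl => /subr0_eq; rewrite -(mulmxA secbase f g) => fg.
rewrite {1}/secmx /conjmx mulmxA fg -3!(mulmxA (secmx f)).
by congr (_ *m _); rewrite /secmx /conjmx !mulmxA.
Qed.

Lemma secmx_bracket f g : stablemx M f -> stablemx M g -> stablemx W f ->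
  stablemx W g -> secmx (bracketmx f g) = bracketmx (secmx f) (secmx g).
Proof. by move=> *; rewrite /bracketmx secmxD secmxN !secmxM. Qed.

Lemma secmx_eq0 f : stablemx M f -> stablemx W f ->
  secmx f = 0 -> (M *m f <= W)%MS.
Proof.
move=> Mf Wf f0; rewrite -(eqmxMr f eqmx_add_secbase) addsmxMr addsmx_sub Wf.
by have := secmx_sub Mf; rewrite f0 mul0mx subr0.
Qed.

Lemma secmx_nilpotent f k : stablemx M f -> stablemx W f ->
  (0 < k)%N -> f ^+ k = 0 -> secmx f ^+ k = 0.
Proof.
move=> Mf Wf; case: k => // k _ fk0.
suff -> : secmx f ^+ k.+1 = secmx (f ^+ k.+1).
  by rewrite fk0 secmx0.
elim: k {fk0} => [|k IH]; first by rewrite !expr1.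
have Wfk : stablemx W (f ^+ k.+1).
  elim: k {IH} => [|k IH]; first by rewrite expr1.
  by rewrite exprS -mulmxE stablemxM.
by rewrite exprS IH [in RHS]exprS -!mulmxE secmxM.
Qed.

(** This is the correspondence theorem: a subspace X of the section that is
stable lifts to the stable subspace W + X *m secbase between W and M. *)
Lemma minimal_section_irreducible (I : Type) (rho : I -> 'M_n) :
  stable_family rho W -> stable_family rho M -> ~~ (M <= W)%MS ->
  (forall Y : 'M_n, stable_family rho Y -> (W <= Y)%MS -> (Y <= M)%MS ->
     (Y <= W)%MS \/ (M <= Y)%MS) ->
  irreducible_family (fun i => secmx (rho i)).
Proof.
move=> Wr Mr nMW minM; split=> [|X Xst]; first exact: section_gt0.
pose Y := (W + X *m secbase)%MS.
have XC : (X *m secbase <= secbase)%MS by apply: submxMl.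
have Yst : stable_family rho Y.
  move=> i; rewrite addsmxMr addsmx_sub (submx_trans (Wr i)) ?addsmxSl //=.
  rewrite -mulmxA -(subrK (secmx (rho i) *m secbase) (secbase *m rho i)).
  rewrite mulmxDr mulmxA addmx_sub //.
    by rewrite (submx_trans _ (addsmxSl _ _)) // mulmx_sub // secmx_sub.
  by rewrite (submx_trans _ (addsmxSr _ _)) // submxMr.
have YM : (Y <= M)%MS by rewrite -eqmx_add_secbase addsmxS.
have [YW|MY] := minM Y Yst (addsmxSl _ _) YM; [left | right].
  have: (X *m secbase <= (M :\: W) :&: W)%MS.
    rewrite sub_capmx (submx_trans _ YW) ?addsmxSr // andbT.
    by rewrite (submx_trans XC) ?eq_row_base.
  rewrite capmx_diff submx0 => /eqP XC0.
  apply: (row_free_inj (row_base_free _)).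
  by rewrite mul0mx; apply: XC0.
rewrite -col_leq_rank -(leq_add2l (\rank W)) -rank_section.
rewrite (leq_trans (mxrankS MY)) // (leq_trans (mxrank_adds_leqif _ _)) //.
by rewrite leq_add2l mxrankM_maxl.
Qed.

End StableSection.

(** Among the stable subspaces that strictly contain W, take one of smallest
rank. *)
Lemma exists_irreducible_section (K : fieldType) n (I : Type)
    (rho : I -> 'M[K]_n) (W : 'M_n) :
    stable_family rho W -> ~~ row_full W ->
  exists M : 'M_n, [/\ stable_family rho M, (W <= M)%MS, ~~ (M <= W)%MS &
    irreducible_family (fun i => secmx W M (rho i))].
Proof.
move=> Wst nfW.
have [r] := ubnP (\rank (1%:M : 'M[K]_n)).
have: stable_family rho (1%:M : 'M_n) by move=> i; rewrite submx1.
have: ~~ (1%:M <= W)%MS by rewrite sub1mx.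
have: (W <= 1%:M)%MS by rewrite submx1.
elim: r 1%:M => // r IHr M WM nMW Mst; rewrite ltnS => rM.
case: (classic (exists Y : 'M_n, [/\ stable_family rho Y, (W <= Y)%MS,
  (Y <= M)%MS & ~~ (Y <= W)%MS && ~~ (M <= Y)%MS])) => [[Y]|noY].
  case=> Yst WY YM /andP[nYW nMY]; apply: (IHr Y) => //.
  by rewrite (leq_trans _ rM) // (ltn_leqif (mxrank_leqif_sup YM)).
exists M; split=> //; apply: minimal_section_irreducible => // Y Yst WY YM.
apply: NNPP => /not_or_and[/negP nYW /negP nMY]; apply: noY.
by exists Y; rewrite nYW.
Qed.

(** A matrix of largest rank with row space inside P does it. This lets
subspaces be given by conditions that range over infinite families. *)
Lemma subspace_mx (K : fieldType) n (P : 'rV[K]_n -> Prop) :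
    P 0 -> (forall a u v, P u -> P v -> P (a *: u + v)) ->
  exists Z : 'M[K]_n, forall u, P u <-> (u <= Z)%MS.
Proof.
move=> P0 PD.
suff [Z ZP PZ] : exists2 Z : 'M[K]_n, (forall u : 'rV_n, (u <= Z)%MS -> P u) &
    forall u, P u -> (u <= Z)%MS.
  by exists Z => u; split; [apply: PZ | apply: ZP].
have : forall u : 'rV_n, (u <= (0 : 'M[K]_n))%MS -> P u.
  by move=> u; rewrite submx0 => /eqP->.
have [r] := ubnP (n - \rank (0%R : 'M[K]_n)).
elim: r (0 : 'M[K]_n) => // r IH Z; rewrite ltnS => Zr ZP.
case: (classic (exists2 u, P u & ~~ (u <= Z)%MS)) =>
  [[u Pu uZ]|noZ]; last first.
  exists Z => // u Pu; apply/negPn/negP => uZ; apply: noZ; by exists u.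
apply: (IH (Z + u)%MS) => [|v /sub_addsmxP[[a b] /= ->]].
  apply: leq_trans Zr; have ltZ : (\rank Z < \rank (Z + u)%MS)%N.
    rewrite (ltn_leqif (mxrank_leqif_sup (addsmxSl _ _))).
    by rewrite addsmx_sub submx_refl.
  by rewrite ltn_sub2l // (leq_trans ltZ) // rank_leq_col.
rewrite [b]mx11_scalar mul_scalar_mx addrC; apply: PD => //; apply: ZP.
exact: submxMl.
Qed.

Lemma irreducible_subspace (K : fieldType) n (I : Type) (rho : I -> 'M[K]_n)
    (P : 'rV[K]_n -> Prop) v :
    irreducible_family rho ->
    P 0 -> (forall a u v, P u -> P v -> P (a *: u + v)) ->
    (forall i u, P u -> P (u *m rho i)) -> P v -> v != 0 ->
  forall u, P u.
Proof.
move=> [_ irr] P0 PD Prho Pv v0; have [Z PZ] := subspace_mx P0 PD.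
move=> u; have [|Z0|Zfull] := irr Z.
- move=> i; apply/row_subP => j; rewrite row_mul.
  by apply/PZ/Prho/PZ; rewrite row_sub.
- by move/PZ: Pv; rewrite Z0 submx0 (negPf v0).
by apply/PZ; rewrite submx_full.
Qed.

(** * Lie's theorem *)

(** This is Schur's lemma: an eigenspace of g is stable under the family. *)
Lemma irreducible_commuting_scalar (K : closedFieldType) n (I : Type)
    (rho : I -> 'M[K]_n) (g : 'M_n) :
    irreducible_family rho -> (forall i, comm_mx g (rho i)) -> is_scalar_mx g.
Proof.
case=> n_gt0 irr gC.
have /closed_rootP[a] : size (char_poly g) != 1%N.
  by rewrite size_char_poly; case: (n) n_gt0.
rewrite -eigenvalue_root_char => ga.
have [|ga0|gfull] := irr (eigenspace g a).
- by move=> i; apply: comm_mx_stable_eigenspace.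
- by case/eqP: ga.
apply/is_scalar_mxP; exists a; apply/eqP.
rewrite -subr_eq0 -[_ - _]mul1mx; apply/eqP/sub_kermxP.
by rewrite sub1mx.
Qed.

(** The family consists of scalars by Schur's lemma, so that any line is
stable. *)
Lemma commuting_irreducible_dim1 (K : closedFieldType) n (I : Type)
    (rho : I -> 'M[K]_n) :
    irreducible_family rho -> (forall i j, comm_mx (rho i) (rho j)) -> n = 1%N.
Proof.
move=> irr rhoC; have [n_gt0 irr'] := irr.
have [|W0|Wfull] := irr' (delta_mx (Ordinal n_gt0) (Ordinal n_gt0)).
- move=> i; have /is_scalar_mxP[a ->] :=
    irreducible_commuting_scalar irr (rhoC i).
  by rewrite mul_mx_scalar scalemx_sub.
- by move/matrixP/(_ (Ordinal n_gt0) (Ordinal n_gt0))/eqP: W0;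
    rewrite !mxE !eqxx oner_eq0.
by move: Wfull; rewrite /row_full mxrank_delta => /eqP.
Qed.

(** This is Lie's theorem for a Lie algebra with a flag of ideals, the j-th
ideal being spanned by the f k with k <= j. By induction on j the f k with k <
j are scalars, so that [f i, f j] is a multiple of f j plus a scalar. Let u be
the traceless part of f j. As brackets have trace 0 and the dimension is
nonzero in K, [f i, u] = c u for some c. Then the kernel of u is stable, so u
is 0 or invertible. In the latter case [f i, u] u^-1 = c has trace 0, so c = 0,
and u commutes with the family: it is a scalar by Schur's lemma. *)
Lemma lie_irreducible_scalar (K : closedFieldType) d m (f : 'I_m -> 'M[K]_d) :
    [pchar K] =i pred0 -> irreducible_family f ->
    (forall i j : 'I_m, exists2 c : 'I_m -> K,
       forall k : 'I_m, (j < k)%N -> c k = 0 &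
       bracketmx (f i) (f j) = \sum_k c k *: f k) ->
  forall j, is_scalar_mx (f j).
Proof.
move=> char0 irr rel j; have [d_gt0 irr'] := irr.
have [r] := ubnP (nat_of_ord j); elim: r j => // r IH j; rewrite ltnS => jr.
have d0 : d%:R != 0 :> K by rewrite ((pcharf0P K).1 char0) -lt0n.
pose t := \tr (f j) / d%:R; pose u := f j - t%:M.
have tru : \tr u = 0.
  by rewrite linearB /= mxtrace_scalar -mulr_natr divfK // subrr.
have uC i : exists c, bracketmx (f i) u = c *: u.
  have [c c0 fij] := rel i j.
  have [s fs] : exists s, \sum_(k | k != j) c k *: f k = s%:M.
    apply/is_scalar_mxP; rewrite -memmx1 linear_sum summx_sub // => k kj.
    rewrite memmx1; case: (ltngtP k j) => [ltkj|ltjk|/val_inj kj'];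
      last 1 first.
    - by rewrite kj' eqxx in kj.
    - have /is_scalar_mxP[a ->] := IH k (leq_trans ltkj jr).
      by rewrite scale_scalar_mx scalar_mx_is_scalar.
    - by rewrite c0 // scale0r mx0_is_scalar.
  have e : bracketmx (f i) u = c j *: u + (c j * t + s)%:M.
    rewrite /bracketmx /u mulmxBr mulmxBl scalar_mxC opprB addrA subrK.
    rewrite -/(bracketmx _ _) fij (bigD1 j) //= fs scalerBr.
    by rewrite (raddfD scalar_mx) addrA scale_scalar_mx subrK.
  have /eqP := mxtrace_bracketmx (f i) u.
  rewrite e linearD linearZ /= tru mulr0 add0r mxtrace_scalar -mulr_natr.
  rewrite mulf_eq0 (negPf d0) orbF => /eqP s0.
  by exists (c j); rewrite s0 (raddf0 scalar_mx) addr0.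
have fE : f j = u + t%:M by rewrite subrK.
have scal_u : is_scalar_mx u -> is_scalar_mx (f j).
  move=> /is_scalar_mxP[a ua]; rewrite fE ua -(raddfD scalar_mx).
  exact: scalar_mx_is_scalar.
have [|ku0|kufull] := irr' (kermx u); first 2 last.
- apply: scal_u; suff -> : u = 0 by apply: mx0_is_scalar.
  by rewrite -[u]mul1mx; apply/sub_kermxP; rewrite sub1mx.
- move=> i; apply/sub_kermxP; have [c ciu] := uC i.
  have -> : kermx u *m f i *m u = kermx u *m (bracketmx (f i) u + u *m f i).
    by rewrite subrK mulmxA.
  rewrite ciu mulmxDr mulmxA mulmx_ker mul0mx -scalemxAr mulmx_ker.
  by rewrite scaler0 addr0.
have uU : u \in unitmx by rewrite -row_free_unit -kermx_eq0 ku0.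
apply/scal_u/(irreducible_commuting_scalar irr) => i.
have [c ciu] := uC i; apply/esym/eqP; rewrite -subr_eq0 -/(bracketmx _ _) ciu.
suff -> : c = 0 by rewrite scale0r.
have := congr1 (fun g => \tr (g *m invmx u)) ciu.
rewrite /= mulmxBl linearB /= mulmxK // -scalemxAl mulmxV //.
rewrite linearZ /= mxtrace1.
rewrite -mulmxA mxtrace_mulC -mulmxA mulVmx // mulmx1 subrr => /esym/eqP.
by rewrite mulf_eq0 (negPf d0) orbF => /eqP.
Qed.

(** * Weakly closed sets of nilpotent matrices *)

Definition words_vanish (K : fieldType) n (G : 'M[K]_n -> Prop) (k : nat) :=
  forall s : seq 'M_n, (forall g, g \in s -> G g) -> size s = k ->
    \prod_(g <- s) g = 0.

(** A product of k elements of G kills a stable subspace of rank at least k;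
this subspace is the whole space when k = n. *)
Lemma words_vanish_of_chain (K : fieldType) n (I : Type) (rho : I -> 'M[K]_n)
    (G : 'M_n -> Prop) :
    (forall W : 'M_n, stable_family rho W -> ~~ row_full W ->
     exists M : 'M_n, [/\ stable_family rho M, (W < M)%MS &
       forall g, G g -> (M *m g <= W)%MS]) ->
  words_vanish G n.
Proof.
move=> step.
have chain k : (k <= n)%N -> exists W : 'M_n, [/\ stable_family rho W,
    (k <= \rank W)%N & forall s : seq 'M_n, (forall g, g \in s -> G g) ->
      size s = k -> W *m \prod_(g <- s) g = 0].
  elim: k => [_|k IH ltkn].
    exists 0; split=> // [i|s _ _]; first by rewrite mul0mx.
    by rewrite mul0mx.
  have [W [Wst kW Wk]] := IH (ltnW ltkn).
  have [M [Mst WM Mk]] : exists M : 'M_n, [/\ stable_family rho M,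
      (k < \rank M)%N & forall g, G g -> (M *m g <= W)%MS].
    have [Wfull|nWfull] := boolP (row_full W).
      by exists W; rewrite (eqP Wfull); split=> // g _; apply: submx_full.
    have [M [Mst ltWM MG]] := step W Wst nWfull; exists M; split=> //.
    by move: ltWM; rewrite ltmxErank => /andP[_]; apply: leq_ltn_trans.
  exists M; split=> // -[|g s] //= sG [sk].
  rewrite big_cons -mulmxE mulmxA.
  have /submxP[D ->] := Mk g (sG g (mem_head _ _)).
  by rewrite -mulmxA Wk ?mulmx0 // => h hs; apply: sG; rewrite inE hs orbT.
move=> s sG sn; have [W [_ nW Wn]] := chain n (leqnn n).
have Wfull : row_full W by rewrite -col_leq_rank.
have := Wn s sG sn => /(canRL (mulKmx _)) ->;
  by rewrite ?mulmx0 -?row_full_unit.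
Qed.

(** As long as some g in G keeps the vector in P, apply g and start again:
this stops before k steps. With P the complement of a subspace W, this
is a vector outside W that G maps into W. *)
Lemma words_vanish_killed (K : fieldType) n (G : 'M[K]_n -> Prop) k
    (P : 'rV[K]_n -> Prop) (v : 'rV_n) :
    words_vanish G k -> P v -> ~ P 0 ->
  exists2 w, P w & forall g, G g -> ~ P (w *m g).
Proof.
move=> Gk Pv nP0; apply: NNPP => nokill.
have chain j : exists s : seq 'M_n, [/\ forall g, g \in s -> G g, size s = j &
    P (v *m \prod_(g <- s) g)].
  elim: j => [|j [s [sG sj Ps]]]; first by exists [::]; rewrite big_nil mulmx1.
  case: (classic (exists2 g, G g & P (v *m \prod_(g <- s) g *m g))) =>
    [[g Gg Pg]|nog].
    exists (rcons s g); rewrite size_rcons sj -cats1 big_cat big_seq1 /=.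
    rewrite -mulmxE mulmxA cats1.
    by split=> // h; rewrite mem_rcons inE => /orP[/eqP->|/sG].
  case: nokill; exists (v *m \prod_(g <- s) g) => // g Gg Pg.
  by apply: nog; exists g.
by have [s [sG sk]] := chain k; rewrite (Gk s) // mulmx0.
Qed.

Lemma span_closed (K : fieldType) (V : vectType K) (X : seq V)
    (P : V -> Prop) :
    P 0 -> (forall a x y, P x -> P y -> P (a *: x + y)) ->
    (forall x, x \in X -> P x) ->
  forall h, h \in <<X>>%VS -> P h.
Proof.
move=> P0 PD PX h hX; rewrite (@coord_span _ _ _ (in_tuple X) h hX).
by elim/big_ind: _ => // [x y Px Py|i _];
  [rewrite -[x]scale1r | rewrite -[_ *: _]addr0];
  apply: PD => //; apply: PX; rewrite mem_nth.
Qed.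

Lemma words_vanish_geq (K : fieldType) n (G : 'M[K]_n -> Prop) k s :
    words_vanish G k -> (forall g, g \in s -> G g) -> (k <= size s)%N ->
  \prod_(g <- s) g = 0.
Proof.
move=> Gk sG ks; rewrite -(cat_take_drop k s) big_cat /= Gk ?mul0r //.
  by move=> g /mem_take/sG.
by rewrite size_takel.
Qed.

(** Engel's theorem in Jacobson's form: S is closed under brackets but need not
be a subspace, and only its elements are known to be nilpotent. As in the
classical proof, a space H with vanishing words is enlarged by one matrix s that
normalizes it, but H must be spanned by elements of S, and s must be in
S. *)
Section WeaklyClosed.
Variables (K : fieldType) (n : nat) (S : 'M[K]_n -> Prop).
Hypothesis S_bracket : forall f g, S f -> S g -> S (bracketmx f g).
Hypothesis S_nil : forall f, S f -> exists k, f ^+ k = 0.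

(** If there is no such s, bracketing s0 again and again with suitable elements
of X never leads into H. But the bracket of k elements of X with s0 is a sum of
terms w s0 w' where w and w' are products of elements of X with k factors in
total; if k = 2n then one of them has at least n factors, and vanishes. *)
Lemma exists_normalizing (X : seq 'M[K]_n) s0 :
    let H := <<X>>%VS in
    (forall x, x \in X -> S x) -> words_vanish (fun f => f \in H) n ->
    S s0 -> s0 \notin H ->
  exists s, [/\ S s, s \notin H & forall h, h \in H -> bracketmx h s \in H].
Proof.
move=> H XS Hn Ss0 s0H; apply: NNPP => nos.
have step u : S u -> u \notin H ->
    exists2 t, t \in X & bracketmx t u \notin H.
  move=> Su uH; apply: NNPP => not; apply: nos; exists u; split=> //.
  apply: span_closed => [|a x y xu yu|x xX].
  - by rewrite bracket0mx mem0v.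
  - by rewrite bracketmxDl bracketmxZl rpredD // rpredZ.
  by apply/negPn/negP => xuH; apply: not; exists x.
have chain k : exists u, [/\ S u, u \notin H & forall w w' : seq 'M_n,
    {subset w <= H} -> {subset w' <= H} ->
    (* u behaves like a bracket of k elements of X with s0 *)
    (n + n <= size w + size w' + k)%N ->
    (\prod_(f <- w) f) * u * (\prod_(f <- w') f) = 0].
  elim: k => [|k [u [Su uH uk]]].
    exists s0; split=> // w w' wH w'H; rewrite addn0 => nww'.
    have [nw|wn] := leqP n (size w).
      by rewrite (words_vanish_geq Hn) ?mul0r.
    rewrite [\prod_(f <- w') f](words_vanish_geq Hn) ?mulr0 //.
    by rewrite -(leq_add2l n) (leq_trans nww') // leq_add2r ltnW.
  have [t tX tuH] := step u Su uH.
  have tH : t \in H by apply: memv_span.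
  exists (bracketmx t u); split=> // [|w w' wH w'H nk].
    by apply: S_bracket => //; apply: XS.
  rewrite /bracketmx !mulmxE mulrBr mulrBl !mulrA.
  have := uk (rcons w t) w'; rewrite -cats1 big_cat big_seq1 /= => -> //;
    last 2 first.
  - by move=> f; rewrite mem_cat inE => /orP[/wH|/eqP->].
  - by rewrite size_cat addn1 !addSn -!addnS.
  have := uk w (t :: w'); rewrite big_cons /= !mulrA => -> //; rewrite ?subrr //.
  - by move=> f; rewrite inE => /orP[/eqP->|/w'H].
  - by rewrite addnS addSn -addnS.
have [u [_ uH]] := chain (n + n)%N.
move=> /(_ [::] [::]); rewrite !big_nil mulr1 mul1r => u0.
by rewrite u0 ?mem0v // in uH.
Qed.

(** Given a proper stable W, the vectors that H maps into W form a subspace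
which is larger than W and, as s normalizes H, stable under s. As s is
nilpotent, one of these vectors outside W is mapped into W by s too. *)
Lemma words_vanish_extend (H : {vspace 'M[K]_n}) s :
    words_vanish (fun f => f \in H) n -> S s ->
    (forall h, h \in H -> bracketmx h s \in H) ->
  words_vanish (fun f => f \in (H + <[s]>)%VS) n.
Proof.
move=> Hn Ss Hs.
apply: (@words_vanish_of_chain _ _ {f : 'M[K]_n | f \in (H + <[s]>)%VS} sval).
move=> W Wst nfW.
have HW h : h \in H -> stablemx W h.
  move=> hH; have hH' : h \in (H + <[s]>)%VS by rewrite (subvP (addvSl _ _)).
  exact: (Wst (exist _ h hH')).
have sW : stablemx W s.
  have sH' : s \in (H + <[s]>)%VS by rewrite (subvP (addvSr _ _)) // memv_line.
  exact: (Wst (exist _ s sH')).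
have [v vW] : exists v : 'rV_n, ~~ (v <= W)%MS.
  by move: nfW; rewrite -sub1mx => /row_subPn[i]; exists (row i 1%:M).
have [w /negP wW wH] := @words_vanish_killed _ _ _ _
  (fun v => ~ (v <= W)%MS) v Hn (elimN idP vW)
  (fun nP => nP (sub0mx _ _)).
have {}wH h : h \in H -> (w *m h <= W)%MS by move=> /wH/NNPP.
pose P (u : 'rV[K]_n) := ~~ (u <= W)%MS /\
  forall h, h \in H -> (u *m h <= W)%MS.
have Ps u k : P u -> s ^+ k = 0 -> exists2 u', P u' & (u' *m s <= W)%MS.
  move=> Pu sk; apply: NNPP => nou'.
  suff: P (u *m s ^+ k) by rewrite sk mulmx0 => -[]; rewrite sub0mx.
  elim: k {sk} => [|k [IH1 IH2]]; first by rewrite mulmx1.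
  rewrite exprSr -mulmxE mulmxA; split=> [|h hH].
    by apply/negP => us; apply: nou'; exists (u *m s ^+ k).
  have -> : u *m s ^+ k *m s *m h =
      u *m s ^+ k *m h *m s - u *m s ^+ k *m bracketmx h s.
    by rewrite /bracketmx mulmxBr !mulmxA opprB addrC subrK.
  rewrite addmx_sub ?(eqmx_opp _) ?IH2 ?Hs // (submx_trans _ sW) // submxMr //.
  exact: IH2.
have [k sk] := S_nil Ss.
have [u [uW uH] us] := Ps w k (conj wW wH) sk.
have uH' g : g \in (H + <[s]>)%VS -> (u *m g <= W)%MS.
  case/memv_addP=> h hH [_ /vlineP[a ->] ->].
  by rewrite mulmxDr addmx_sub ?(uH h hH) // -scalemxAr scalemx_sub.
exists (W + u)%MS; split.
- move=> [g gH] /=; rewrite addsmxMr addsmx_sub (submx_trans _ (addsmxSl _ _)).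
    by rewrite (submx_trans _ (addsmxSl _ _)) // uH'.
  exact: (Wst (exist _ g gH)).
- by rewrite ltmxE addsmxSl addsmx_sub submx_refl.
by move=> g gH; rewrite addsmxMr addsmx_sub uH' // (Wst (exist _ g gH)).
Qed.

(** Enlarge H = <<X>> with X in S, as long as it does not contain S. *)
Theorem weakly_closed_nil : words_vanish S n.
Proof.
suff [H SH Hn] : exists2 H : {vspace 'M[K]_n}, (forall f, S f -> f \in H) &
    words_vanish (fun f => f \in H) n.
  by move=> s sS; apply: Hn => f /sS/SH.
have : exists2 X : seq 'M[K]_n, forall x, x \in X -> S x &
    words_vanish (fun f => f \in <<X>>%VS) n.
  exists [::] => //; rewrite span_nil.
  move=> s s0; case: n s s0 => [|m] [|f s] //= s0 _; first exact: flatmx0.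
  by have := s0 f (mem_head _ _);
    rewrite memv0 big_cons => /eqP->; rewrite mul0r.
move=> [X]; have [r] := ubnP (\dim {:'M[K]_n} - \dim <<X>>).
elim: r X => // r IH X; rewrite ltnS => Xr XS Xn.
case: (classic (forall f, S f -> f \in <<X>>%VS)) => [SX|].
  by exists <<X>>%VS.
move=> /not_all_ex_not[s0 nSs0]; have [Ss0 /negP s0X] := imply_to_and _ _ nSs0.
have [s [Ss sX Xs]] := exists_normalizing XS Xn Ss0 s0X.
have spanE : (<<rcons X s>> = <<X>> + <[s]>)%VS.
  by rewrite -cats1 span_cat span_seq1.
apply: (IH (rcons X s)); rewrite ?spanE.
- apply: leq_trans Xr; rewrite ltn_sub2l //.
    rewrite ltnNge; apply: contra s0X => dimX; have: <<X>>%VS == fullv.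
      by rewrite eqEdim subvf.
    by move/eqP->; rewrite memvf.
  rewrite (ltn_leqif (dimv_leqif_sup (addvSl _ _))) subv_add subvv /=.
  by rewrite -memvE.
- by move=> x; rewrite mem_rcons inE => /orP[/eqP->|/XS].
exact: words_vanish_extend.
Qed.
End WeaklyClosed.

(** * Multiplications in a scalar extension *)

Lemma rV_mulmx_inj (K : fieldType) m n (f g : 'M[K]_(m, n)) :
  (forall u : 'rV_m, u *m f = u *m g) -> f = g.
Proof. by move=> fg; apply/row_matrixP=> i; rewrite !rowE. Qed.

Section MultiplicationMatrices.
Variables (F K : fieldType) (iota : {rmorphism F -> K}) (A : leibnizType F).
Local Notation KA := (scalext iota A).
Local Notation n := (\dim {:A}).

Definition Lmx (x : KA) : 'M[K]_n := lin1_mx (lmul x).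
Definition Rmx (x : KA) : 'M[K]_n := lin1_mx (rmul x).

Lemma mul_Lmx (u : 'rV[K]_n) (x : KA) : u *m Lmx x = lmul x (u : KA).
Proof.
by pose f : {linear KA -> KA} := lmul x; apply: (@mul_rV_lin1 K n n f). Qed.

Lemma mul_Rmx (u : 'rV[K]_n) (x : KA) : u *m Rmx x = lmul (u : KA) x.
Proof.
by pose f : {linear KA -> KA} := rmul x; apply: (@mul_rV_lin1 K n n f). Qed.

Lemma Lmx_is_linear : linear Lmx.
Proof.
move=> a x y; apply: rV_mulmx_inj => u.
by rewrite mul_Lmx mulmxDr -scalemxAr !mul_Lmx lmulDl lmulZl.
Qed.

Lemma Rmx_is_linear : linear Rmx.
Proof.
move=> a x y; apply: rV_mulmx_inj => u.
by rewrite mul_Rmx mulmxDr -scalemxAr !mul_Rmx linearP.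
Qed.

HB.instance Definition _ :=
  GRing.isLinear.Build K KA 'M_n *:%R Lmx Lmx_is_linear.
HB.instance Definition _ :=
  GRing.isLinear.Build K KA 'M_n *:%R Rmx Rmx_is_linear.

Lemma Lmx_lmul x y : Lmx (lmul x y) = bracketmx (Lmx y) (Lmx x).
Proof.
apply: rV_mulmx_inj => u; rewrite /bracketmx mulmxBr !mulmxA !mul_Lmx.
by rewrite leibniz_identity addrK.
Qed.

Lemma Rmx_lmul x y : Rmx (lmul x y) = bracketmx (Rmx y) (Lmx x).
Proof.
apply: rV_mulmx_inj => u; rewrite /bracketmx mulmxBr !mulmxA.
rewrite !(mul_Lmx, mul_Rmx).
by rewrite (leibniz_identity x (u : KA) y) [RHS]addrC addKr.
Qed.

(** In other words (xu + ux)y = 0: expand x(uy) + u(xy) with the Leibniz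
identity. *)
Lemma LRmx_mul_Rmx x y : (Lmx x + Rmx x) *m Rmx y = 0.
Proof.
apply: rV_mulmx_inj => u; rewrite mulmx0 mulmxA mulmxDr mul_Rmx mul_Lmx mul_Rmx.
rewrite lmulDl.
have /eqP := leibniz_identity x (u : KA) y; rewrite -subr_eq => /eqP <-.
have /eqP := leibniz_identity (u : KA) x y; rewrite -subr_eq => /eqP <-.
by rewrite addrC addrA subrK subrr.
Qed.

End MultiplicationMatrices.
Lemma tens1_ind (F K : fieldType) (iota : {rmorphism F -> K}) (N : vectType F)
    (P : scalext iota N -> Prop) :
    (forall x, P (tens1 iota x)) ->
    (forall a u v, P u -> P v -> P (a *: u + v)) -> forall u, P u.
Proof.
move=> P1 PD u; rewrite (scalext_sum u).
have P0 : P 0 by have := PD (-1) _ _ (P1 0) (P1 0); rewrite scaleN1r addNr.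
by elim/big_rec: _ => // i w _ Pw; apply: PD.
Qed.

(** The action of U on A by left multiplications extends to a linear map rho
from the scalar extension of U. The basis that triangularizes U gives a flag of
ideals, so Lie's theorem applies to rho on each irreducible section, where
brackets of scalars vanish. A product xy of U thus maps M into W, for suitable
M above any stable W. *)
Lemma subalgebra_product_nilpotent (F : fieldType) (K : closedFieldType)
    (iota : {rmorphism F -> K}) (A : leibnizType F) (U : subleibniz A) x y :
    [pchar K] =i pred0 -> triangulable iota (subvs_of U) ->
    x \in U -> y \in U ->
  exists k, Lmx (tens1 iota (lmul x y)) ^+ k = 0.
Proof.
move=> char0 [e e_basis e_tri] xU yU; set n := \dim {:A}.
pose N : leibnizType F := subvs_of U; pose UK := scalext iota N.
have [rho rhoE _] : exists2 rho : {linear UK -> 'M[K]_n},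
    (forall u, rho (tens1 iota u) = Lmx (tens1 iota (vsval u))) &
    forall g : {linear UK -> 'M[K]_n}, (forall u : N,
      g (tens1 iota u) = Lmx (tens1 iota (vsval u))) -> g =1 rho.
  apply: (@scalext_universal _ _ iota N 'M[K]_n
    (fun u => Lmx (tens1 iota (vsval u)))).
    by move=> u v; rewrite linearD tens1D linearD.
  by move=> a u; rewrite linearZ tens1Z linearZ.
have rhoM (u v : UK) : rho (lmul u v) = bracketmx (rho v) (rho u).
  elim/tens1_ind: u => [u|a u u' IH IH']; last first.
    rewrite lmulDl lmulZl linearD linearZ /= IH IH' linearP.
    by rewrite bracketmxDr bracketmxZr.
  elim/tens1_ind: v => [v|a v v' IH IH']; last first.
    by rewrite !linearP /= IH IH' bracketmxDl bracketmxZl.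
  have -> : lmul (tens1 iota u : UK) (tens1 iota v) = tens1 iota (lmul u v).
    exact: scalext_lmul_tens1.
  rewrite !rhoE -Lmx_lmul; congr Lmx.
  exact/esym/scalext_lmul_tens1.
pose f (i : 'I_(\dim {:UK})) := rho e`_i.
have rho_sum u : rho u = \sum_i coord e i u *: f i.
  rewrite {1}(coord_basis e_basis (memvf u)) linear_sum.
  by apply: eq_bigr => i _; rewrite linearZ.
have f_stable W u : stable_family f W -> stablemx W (rho u).
  move=> Wf; rewrite rho_sum mulmx_sumr summx_sub // => i _.
  by rewrite -scalemxAr scalemx_sub.
have chain (W : 'M[K]_n) : stable_family f W -> ~~ row_full W ->
    exists M : 'M[K]_n, [/\ stable_family f M, (W < M)%MS &
      forall g, (exists u v, g = rho (lmul u v)) -> (M *m g <= W)%MS].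
  move=> Wf nfW; have [M [Mf WM nMW irr]] := exists_irreducible_section Wf nfW.
  have scal : forall i, is_scalar_mx (secmx W M (f i)).
    apply: (lie_irreducible_scalar char0 irr) => i j.
    exists (fun k => coord e k (lmul e`_j e`_i)) => [k jk|].
      by have [_ /(_ k j jk)] := e_tri e`_i; rewrite mxE.
    rewrite -secmx_bracket // -rhoM rho_sum secmx_sum.
    by apply: eq_bigr => k _; rewrite secmxZ.
  have scal_rho u : is_scalar_mx (secmx W M (rho u)).
    rewrite rho_sum secmx_sum -memmx1 linear_sum summx_sub // => i _.
    rewrite memmx1 secmxZ; have /is_scalar_mxP[a ->] := scal i.
    by rewrite scale_scalar_mx scalar_mx_is_scalar.
  exists M; split=> // [|g [u [v ->]]]; first by rewrite ltmxE WM.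
  apply: secmx_eq0; rewrite ?f_stable // rhoM secmx_bracket ?f_stable //.
  have /is_scalar_mxP[a ->] := scal_rho u.
  by rewrite /bracketmx scalar_mxC subrr.
have words := words_vanish_of_chain chain; exists n.
have := words (nseq n (Lmx (tens1 iota (lmul x y)))).
rewrite size_nseq big_nseq iter_mulr_1; apply=> // g /nseqP[-> _].
exists (tens1 iota (Subvs xU)), (tens1 iota (Subvs yU)).
have -> : lmul (tens1 iota (Subvs xU) : UK) (tens1 iota (Subvs yU)) =
    tens1 iota (lmul (Subvs xU : N) (Subvs yU : N)) by exact: scalext_lmul_tens1.
by rewrite rhoE.
Qed.

(** * Irreducible sections of a Leibniz algebra and triangulation *)

Definition sum_family (I J T : Type) (f : I -> T) (g : J -> T) (k : I + J) :=
  match k with inl i => f i | inr j => g j end.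

(** The common kernel of the R x is stable. If it is everything, R = 0; if it
is 0, then (L x + R x) R y = 0 gives R = - L. In both cases a subspace stable
under L is stable under R. The operators L (xy) have a nonzero common kernel by
weakly_closed_nil, and it is stable under L, so they vanish. Hence the L x
commute. *)
Lemma irreducible_bimodule_dim1 (F : fieldType) (K : closedFieldType)
    (A : leibnizType F) d (L R : A -> 'M[K]_d) :
    (forall x y, L (lmul x y) = bracketmx (L y) (L x)) ->
    (forall x y, R (lmul x y) = bracketmx (R y) (L x)) ->
    (forall x y, (L x + R x) *m R y = 0) ->
    (forall x y, exists k, L (lmul x y) ^+ k = 0) ->
    irreducible_family (sum_family L R) -> d = 1%N.
Proof.
move=> LM RM LRR Lnil irr; have [d_gt0 _] := irr.
have RE : (forall x, R x = 0) \/ (forall x, R x = - L x).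
  pose P (v : 'rV[K]_d) := forall y, v *m R y = 0.
  case: (classic (exists2 v, P v & v != 0)) =>
    [[v Pv v0]|noP]; [left|right] => x.
    apply: rV_mulmx_inj => u; rewrite mulmx0; move: u x.
    apply: (@irreducible_subspace _ _ _ _ P v irr) => //.
    - by move=> y; rewrite mul0mx.
    - by move=> a u w Pu Pw y; rewrite mulmxDl -scalemxAl Pu Pw scaler0 addr0.
    move=> [] x u Pu y /=; last by rewrite Pu mul0mx.
    have := congr1 (mulmx u) (RM x y).
    rewrite Pu /bracketmx mulmxBr !mulmxA Pu mul0mx sub0r => /esym/eqP.
    by rewrite oppr_eq0 => /eqP.
  apply/eqP; rewrite -addr_eq0 addrC; apply/eqP; apply: rV_mulmx_inj => u.
  rewrite mulmx0; apply/eqP/negPn/negP => u0; apply: noP.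
  by exists (u *m (L x + R x)) => // y; rewrite -mulmxA LRR mulmx0.
have Rstable (P : 'rV[K]_d -> Prop) : P 0 ->
    (forall a u v, P u -> P v -> P (a *: u + v)) ->
    (forall x u, P u -> P (u *m L x)) ->
    forall i u, P u -> P (u *m sum_family L R i).
  move=> P0 PD PL [] x u Pu /=; first exact: PL.
  case: RE => ->; first by rewrite mulmx0.
  by rewrite mulmxN -scaleN1r -[_ *: _]addr0; apply: PD => //; apply: PL.
pose S g := exists x y, g = L (lmul x y).
have words : words_vanish S d.
  apply: weakly_closed_nil => [f g [x [y ->]] [z [t ->]]|f [x [y ->]]].
    by exists (lmul z t), (lmul x y); rewrite -LM.
  exact: Lnil.
have v0 : (const_mx 1 : 'rV[K]_d) <> 0.
  by move/rowP/(_ (Ordinal d_gt0))/eqP; rewrite !mxE oner_eq0.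
have [w /eqP w0 wS] := @words_vanish_killed _ _ _ _ (fun v => v <> 0) _
  words v0 (fun nP => nP erefl).
pose P (v : 'rV[K]_d) := forall x y, v *m L (lmul x y) = 0.
have P0 : P 0 by move=> x y; rewrite mul0mx.
have PD a u v : P u -> P v -> P (a *: u + v).
  by move=> Pu Pv x y; rewrite mulmxDl -scalemxAl Pu Pv scaler0 addr0.
have PS : forall v, P v.
  apply: (irreducible_subspace (v := w) irr P0 PD) => //; last first.
    by move=> x y; apply: NNPP; apply: wS; exists x, y.
  apply: Rstable => // z u Pu x y.
  have := congr1 (mulmx u) (LM z (lmul x y)).
  rewrite Pu /bracketmx mulmxBr !mulmxA Pu mul0mx sub0r => /esym/eqP.
  by rewrite oppr_eq0 => /eqP.
have LC x y : comm_mx (L x) (L y).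
  apply/eqP; rewrite -subr_eq0 -/(bracketmx _ _) -LM; apply/eqP.
  by apply: rV_mulmx_inj => u; rewrite PS mulmx0.
apply: (commuting_irreducible_dim1 irr) => -[] x [] y /=;
  case: RE => RE; rewrite ?RE //;
  rewrite /comm_mx ?mul0mx ?mulmx0 ?mulNmx ?mulmxN ?mulNmx //; by rewrite LC.
Qed.

Section Triangulation.
Variables (F : fieldType) (K : closedFieldType) (iota : {rmorphism F -> K}).
Variable A : leibnizType F.
Local Notation KA := (scalext iota A).
Local Notation n := (\dim {:A}).

Definition bimodule_family : A + A -> 'M[K]_n :=
  sum_family (fun x => Lmx (tens1 iota x)) (fun x => Rmx (tens1 iota x)).

Hypothesis product_nilpotent :
  forall x y : A, exists k, Lmx (tens1 iota (lmul x y)) ^+ k = 0.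

(** Only multiplications by the elements 1 tensor x are used here, because the
nilpotency assumption is about them; triangular_flag extends to all of A_K by
linearity. *)
Lemma bimodule_extend (W : 'M[K]_n) :
    stable_family bimodule_family W -> ~~ row_full W ->
  exists2 v : 'rV[K]_n, ~~ (v <= W)%MS &
    forall i, (v *m bimodule_family i <= W + v)%MS.
Proof.
move=> Wst nfW; have [M [Mst WM nMW irr]] := exists_irreducible_section Wst nfW.
pose L x := secmx W M (Lmx (tens1 iota x)).
pose R x := secmx W M (Rmx (tens1 iota x)).
have LW x : stablemx W (Lmx (tens1 iota x)) := Wst (inl x).
have RW x : stablemx W (Rmx (tens1 iota x)) := Wst (inr x).
have LM x : stablemx M (Lmx (tens1 iota x)) := Mst (inl x).
have RM x : stablemx M (Rmx (tens1 iota x)) := Mst (inr x).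
have mulE x y : tens1 iota (lmul x y) = lmul (tens1 iota x : KA) (tens1 iota y).
  exact/esym/scalext_lmul_tens1.
have dim1 : \rank (M :\: W) = 1%N.
  apply: (@irreducible_bimodule_dim1 F K A _ L R) => [x y|x y|x y|x y|].
  - by rewrite /L mulE Lmx_lmul secmx_bracket.
  - by rewrite /R mulE Rmx_lmul secmx_bracket.
  - by rewrite /L /R -secmxD -secmxM ?LRmx_mul_Rmx ?secmx0 // mulmxDr addmx_sub.
  - have [k k0] := product_nilpotent x y; exists k.+1.
    by apply: secmx_nilpotent; rewrite // exprS k0 mulr0.
  by case: irr => d0 irr; split=> // X Xst; apply: irr => -[] x;
    [apply: (Xst (inl x)) | apply: (Xst (inr x))].
have [i iW] := row_subPn nMW.
exists (row i M) => // j; apply: submx_trans (_ : M <= _)%MS.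
  by rewrite (submx_trans _ (Mst j)) // submxMr // row_sub.
have WvM : (W + row i M <= M)%MS by rewrite addsmx_sub WM row_sub.
rewrite -(mxrank_leqif_sup WvM) eqn_leq (mxrankS WvM) /=.
rewrite (rank_section WM) dim1 addn1.
by rewrite (ltn_leqif (mxrank_leqif_sup (addsmxSl _ _))) addsmx_sub submx_refl.
Qed.

Lemma triangular_flag k : (k <= \dim {:KA})%N ->
  exists s : seq KA, [/\ size s = k, free s &
    forall (i : nat) (x : KA), (i < k)%N ->
    lmul x s`_i \in <<take i.+1 s>>%VS /\ lmul s`_i x \in <<take i.+1 s>>%VS].
Proof.
elim: k => [|k IH ltk]; first by exists [::]; rewrite nil_free.
have [s [sk sfree stri]] := IH (ltnW ltk).
have [Z ZP] : exists Z : 'M[K]_n, forall u : KA, u \in <<s>>%VS <-> (u <= Z)%MS.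
  apply: subspace_mx => [|a u v us vs]; first exact: mem0v.
  by rewrite rpredD ?rpredZ.
have sstable x u : u \in <<s>>%VS ->
    lmul x u \in <<s>>%VS /\ lmul u x \in <<s>>%VS.
  move: u; apply: span_closed => [|a u v [xu ux] [xv vx]|u us].
  - by rewrite -/(rmul x 0) !linear0 mem0v.
  - by rewrite linearP lmulDl lmulZl !rpredD ?rpredZ.
  have us' : (index u s < k)%N by rewrite -sk index_mem.
  have sub : (<<take (index u s).+1 s>> <= <<s>>)%VS.
    by apply: sub_span => w /mem_take.
  have [] := stri _ x us'; rewrite nth_index // => xu ux.
  by split; apply: (subvP sub).
have Zst : stable_family bimodule_family Z.
  move=> i; apply/row_subP => j; rewrite row_mul; apply/ZP.
  have /ZP/sstable jZ := row_sub j Z.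
  by case: i => x /=; rewrite ?mul_Lmx ?mul_Rmx; case: (jZ (tens1 iota x)).
have nfZ : ~~ row_full Z.
  apply: contraL ltk => Zfull; rewrite -leqNgt -sk.
  suff <- : <<s>>%VS = fullv by apply: dim_span.
  by apply/vspaceP => u; rewrite memvf; apply/ZP/submx_full.
have [v vZ vst] := bimodule_extend Zst nfZ.
have spanE : (<<rcons s v>> = <<s>> + <[v : KA]>)%VS.
  by rewrite -cats1 span_cat span_seq1.
exists (rcons s (v : KA)); split; first by rewrite size_rcons sk.
  rewrite (perm_free (_ : perm_eq _ (v :: s))) ?perm_rcons //.
  rewrite free_cons sfree andbT.
  by apply/negP => /ZP; apply/negP.
have vstep i : v *m bimodule_family i \in <<rcons s v>>%VS.
  have /sub_addsmxP[[a b] /= ->] := vst i.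
  rewrite spanE memv_add //; first by apply/ZP; rewrite submxMl.
  by rewrite [b]mx11_scalar mul_scalar_mx memvZ // memv_line.
move=> i x; rewrite ltnS leq_eqVlt => /orP[/eqP->|ik].
  rewrite nth_rcons sk ltnn eqxx take_oversize ?size_rcons ?sk //.
  elim/tens1_ind: x => [x|a x y [xv vx] [yv vy]].
    by rewrite -mul_Lmx -mul_Rmx; split;
      [apply: (vstep (inl x)) | apply: (vstep (inr x))].
  by rewrite lmulDl lmulZl linearP !rpredD ?rpredZ.
by rewrite nth_rcons sk ik -cats1 takel_cat ?sk //; apply: stri.
Qed.

Lemma triangulable_of_product_nilpotent : triangulable iota A.
Proof.
have [s [sn sfree stri]] := triangular_flag (leqnn _).
have sn' : size s == \dim {:KA} by rewrite sn.
pose e := Tuple sn'; have coord_take (i : 'I_(\dim {:KA})) j w : (j < i)%N ->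
    w \in <<take j.+1 s>>%VS -> coord e i w = 0.
  move=> ji; move: w; apply: span_closed => [|a u v u0 v0|w].
  - exact: linear0.
  - by rewrite linearP /= u0 v0 mulr0 addr0.
  move=> /(nthP 0)[k]; rewrite size_take_min leq_min => /andP[kj ks].
  rewrite nth_take // => <-; rewrite sn in ks.
  rewrite (coord_free (Ordinal ks) i) //= -val_eqE /= ltn_eqF //.
  by rewrite (leq_trans kj).
exists e => [|x].
  by rewrite basisEfree sfree subvf /= sn.
by split=> i j ji; rewrite mxE; apply: (coord_take i j) => //;
  have [] := stri j x (ltn_ord j).
Qed.

End Triangulation.

(* K, with iota : F -> K, is an algebraic closure of F. *)
Theorem corollary2 (F : fieldType) (charF0 : [pchar F] =i pred0)
    (K : closedFieldType) (iota : {rmorphism F -> K})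
    (algK : forall z : K, algebraicOver iota z) :
  recognizable 2 (triangulable iota).
Proof.
move=> A two_gen; apply: triangulable_of_product_nilpotent => x y.
have [U genU] := generated_by_exists [:: x; y].
have xyU : {subset [:: x; y] <= U} := genU.1.
apply: (@subalgebra_product_nilpotent F K iota A U).
- by move=> p; rewrite (fmorph_pchar iota) charF0.
- exact: (two_gen [tuple x; y]).
- by apply: xyU; rewrite mem_head.
by apply: xyU; rewrite !inE eqxx orbT.
Qed.
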